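(* Let $(\Omega,\Sigma,\mu)$ be a measure space, $X(\mu)$ an ideal function space with the $\sigma$-property, $E$ a Banach space and $T\colon X(\mu)\to E$ an order-w continuous linear operator. Then $[i]\colon X(\mu)\to L^1(m_T)$ is well defined, $T=I_{m_T}\circ[i]$, and $I_{m_T}\colon L^1(m_T)\to E$ is order-w continuous. Moreover, this factorization is optimal: if $\xi$ is a measure on $\Sigma$ with $\xi\ll\mu$, $Z(\xi)$ is an ideal function space such that $[i]\colon X(\mu)\to Z(\xi)$ is well defined, and $S\colon Z(\xi)\to E$ is an order-w continuous linear operator with $T=S\circ[i]$, then $[i]\colon Z(\xi)\to L^1(m_T)$ is well defined and $S=I_{m_T}\circ[i]$.
   Context: $L^0(\lambda)$: $\lambda$-a.e. classes of $\Sigma$-measurable real functions. Ideal function space (i.f.s.) $Y(\lambda)$: a vector subspace of $L^0(\lambda)$ with $f\in Y(\lambda)$, $g\in L^0(\lambda)$, $|g|\le|f|$ a.e. $\Rightarrow g\in Y(\lambda)$. $\sigma$-property: $\Omega=\bigcup_n\Omega_n$ with $\Omega_n\in\Sigma$, $\chi_{\Omega_n}\in X(\mu)$. For set functions $\lambda,\xi$ on $\Sigma$, $\xi\ll\lambda$ means $\lambda(A)=0\Rightarrow\xi(A)=0$; then $[i]$ sends the $\lambda$-class of $f$ to its $\xi$-class, and ''$[i]\colon Y(\lambda)\to Z(\xi)$ is well defined'' means $\xi\ll\lambda$ and the $\xi$-class of every $f\in Y(\lambda)$ lies in $Z(\xi)$. An operator $T$ on an i.f.s. is order-w continuous if $T(f_n)\to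 T(f)$ weakly whenever $0\le f_n\uparrow f$ a.e. with $f_n,f$ in the space. $\Sigma_{X(\mu)}=\{A\in\Sigma:\chi_A\in X(\mu)\}$ is a $\delta$-ring with local $\sigma$-algebra $\Sigma$, and $m_T\colon\Sigma_{X(\mu)}\to E$, $m_T(A)=T(\chi_A)$; for order-w continuous $T$ this is a countably additive vector measure. For a vector measure $m$ on $\Sigma_{X(\mu)}$: $|x^*m|$ is the variation of $x^*\circ m$ on $\Sigma$, $\|m\|(A)=\sup_{x^*\in B_{E^*}}|x^*m|(A)$, $L^0(m)$ is the space of $\Sigma$-measurable functions modulo $\|m\|$-null sets, and $L^1(m)$ consists of $f\in L^0(m)$ with $f\in L^1(|x^*m|)$ for all $x^*\in E^*$ such that for each $A\in\Sigma$ there is $\int_Af\,dm\in E$ with $x^*(\int_Af\,dm)=\int_Af\,dx^*m$ for all $x^*$; it is an i.f.s. (over any measure on $\Sigma$ with the same null sets as $\|m\|$) with norm $\sup_{x^*\in B_{E^*}}\int|f|\,d|x^*m|$; $I_m(f)=\int_\Omega f\,dm$. *)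

(* Defs.v *)
From HB Require Import structures.
From mathcomp Require Import all_boot all_order all_algebra.
From mathcomp Require Import all_classical all_reals all_analysis.
Set Implicit Arguments. Unset Strict Implicit. Unset Printing Implicit Defensive.
Import Order.TTheory GRing.Theory Num.Theory.
Import numFieldNormedType.Exports.
Local Open Scope classical_set_scope.
Local Open Scope ring_scope.

Section Defs.
Context {R : realType} {d : measure_display} {T : measurableType d}.

Definition ae_wrt (lam : set T -> \bar R) (P : T -> Prop) : Prop :=
  exists N, [/\ measurable N, lam N = 0%E & ~` [set x | P x] `<=` N].

Definition abs_cont (xi lam : set T -> \bar R) : Prop :=
  forall A, measurable A -> lam A = 0%E -> xi A = 0%E.

(** Ideal function space over [lam]: a set of representatives of
    lam-a.e. classes of Sigma-measurable functions, closed under linear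
    combinations and solid w.r.t. |g| <= |f| lam-a.e. *)
Definition ideal_fs (lam : set T -> \bar R) (Y : set (T -> R)) : Prop :=
  [/\ forall f : T -> R, Y f -> measurable_fun setT f,
      Y (fun _ => 0),
      forall (a : R) f g, Y f -> Y g -> Y (fun x => a * f x + g x) &
      forall (f g : T -> R), Y f -> measurable_fun setT g ->
        ae_wrt lam (fun x => `|g x| <= `|f x|) -> Y g].

Definition sigma_prop (Y : set (T -> R)) : Prop :=
  exists Om : nat -> set T,
    [/\ forall n, measurable (Om n), forall n, Y (\1_(Om n) : T -> R) &
        \bigcup_n Om n = setT].

Context {E : normedModType R}.

Definition dual (xs : E -> R) : Prop :=
  (forall (a : R) (u v : E), xs (a *: u + v) = a * xs u + xs v) /\ continuous xs.

Definition dual_ball (xs : E -> R) : Prop :=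
  dual xs /\ forall u, `|xs u| <= `|u|.

Definition lin_op (lam : set T -> \bar R) (Y : set (T -> R)) (Top : (T -> R) -> E)
  : Prop :=
  (forall (a : R) f g, Y f -> Y g ->
     Top (fun x => a * f x + g x) = a *: Top f + Top g) /\
  (forall f g, Y f -> Y g -> ae_wrt lam (fun x => f x = g x) -> Top f = Top g).

Definition order_w_cont (lam : set T -> \bar R) (Y : set (T -> R))
  (Top : (T -> R) -> E) : Prop :=
  forall (fn : nat -> T -> R) (f : T -> R),
    (forall n, Y (fn n)) -> Y f ->
    ae_wrt lam (fun x => [/\ forall n, 0 <= fn n x,
                            nondecreasing_seq (fun n => fn n x) &
                            (fun n => fn n x) @ \oo --> f x]) ->
    forall xs, dual xs -> (fun n => xs (Top (fn n))) @ \oo --> xs (Top f).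

Definition sigmaX (Y : set (T -> R)) : set (set T) :=
  [set A | measurable A /\ Y (\1_A : T -> R)].

Definition mT (Top : (T -> R) -> E) : set T -> E := fun A => Top (\1_A).

Definition variation (D : set (set T)) (nu : set T -> R) (A : set T) : \bar R :=
  ereal_sup [set s | exists (n : nat) (F : nat -> set T),
    [/\ forall i, (i < n)%N -> D (F i) /\ F i `<=` A,
        trivIset `I_n F & s = ((\sum_(i < n) `|nu (F i)|)%:E)%E]].

Definition pos_var (D : set (set T)) (nu : set T -> R) (A : set T) : \bar R :=
  ereal_sup [set (nu B)%:E | B in [set B | D B /\ B `<=` A]].
Definition neg_var (D : set (set T)) (nu : set T -> R) (A : set T) : \bar R :=
  ereal_sup [set (- nu B)%:E | B in [set B | D B /\ B `<=` A]].

Definition sint (D : set (set T)) (nu : set T -> R) (A : set T) (f : T -> R)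
  : \bar R :=
  (\int[pos_var D nu]_(x in A) (f x)%:E - \int[neg_var D nu]_(x in A) (f x)%:E)%E.

Definition semivar (D : set (set T)) (m : set T -> E) (A : set T) : \bar R :=
  ereal_sup [set variation D (xs \o m) A | xs in dual_ball].

Definition is_vint (D : set (set T)) (m : set T -> E) (A : set T) (f : T -> R)
  (v : E) : Prop :=
  forall xs, dual xs -> ((xs v)%:E = sint D (xs \o m) A f)%E.

(** L^1(m) (representatives of ||m||-a.e. classes) *)
Definition L1v (D : set (set T)) (m : set T -> E) : set (T -> R) :=
  [set f : T -> R | [/\ measurable_fun setT f,
     forall xs, dual xs ->
       (\int[variation D (xs \o m)]_(x in setT) (`|f x|)%:E < +oo)%E &
     forall A, measurable A -> exists v, is_vint D m A f v]].

Definition Ivint (D : set (set T)) (m : set T -> E) (f : T -> R) : E :=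
  xget 0 [set v | is_vint D m setT f v].

End Defs.

(* Main.v *)
(** For a dual functional x* and an order-w continuous S on an ideal space Z, the
scalar functional phi = x* o S is sequentially continuous along increasing
sequences, so nu(A) = phi(1_A) is countably additive on the ideal D of sets
A with 1_A in X. A Hahn decomposition of nu on each piece of a countable
cover by sets of D yields a set P carrying the positive part of nu. Approximating g >= 0 in
Z by simple functions supported in finitely many pieces gives
int g d(nu^+) = phi(g 1_P), and int g d(nu^-) = - phi(g 1_(~P)) in the same
way. Hence int_A g d(nu) = x*(S(g 1_A)), i.e. S(g 1_A) is the vector integral of
g over A, which is unique because the dual separates points (Hahn-Banach). This
settles the optimality statement, of which the factorization of T itself is the
case Z = X, S = T. Order-w continuity of the integral is dominated convergence
with respect to nu^+ and nu^-. *)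

Require Import Defs.
From HB Require Import structures.
From mathcomp Require Import all_boot all_order all_algebra.
From mathcomp Require Import all_classical all_reals all_analysis.
Import Order.TTheory GRing.Theory Num.Theory.
Import numFieldNormedType.Exports.
From mathcomp Require Import measurable_realfun ring lra.
Local Open Scope classical_set_scope.
Local Open Scope ring_scope.

(** * Hahn-Banach *)

(** Partial linear functionals are encoded by their graphs, so that extension becomes set inclusion.
    Single-valuedness is a consequence: domination at [(0, a - b)] and [(0, b - a)] forces
    [a = b]. *)
Definition dominated_graph (R : realType) (E : normedModType R)
    (G : set (E * R)) : Prop :=
  (forall (c : R) x y, G x -> G y -> G (c *: x.1 + y.1, c * x.2 + y.2)) /\
  (forall x, G x -> x.2 <= `|x.1|).

(** The value [s] at [u] must lie above every [x.2 - |x.1 - u|] and below every [|x.1 + u| - x.2].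
    Domination of sums and the triangle inequality put the first family below the second, and [s] is
    the supremum of the first. *)
Lemma dominated_graph_extension (R : realType) (E : normedModType R)
    (G : set (E * R)) (u : E) : dominated_graph R E G -> G (0, 0) ->
  exists (s : R) (H : set (E * R)),
    [/\ dominated_graph R E H, G `<=` H & H (u, s)].
Proof.
move=> [Glin Gdom] G0.
pose L := [set x.2 - `|x.1 - u| | x in G].
have Lub x : G x -> ubound L (`|x.1 + u| - x.2).
  move=> Gx _ [y Gy <-]; have := Gdom _ (Glin 1 _ _ Gx Gy) => /=.
  rewrite scale1r mul1r => h.
  have : `|x.1 + y.1| <= `|x.1 + u| + `|y.1 - u|.
    by rewrite (le_trans _ (ler_normD _ _))// addrACA subrr addr0.
  by lra.
have Lsup : has_sup L.
  by split; [exists (0 - `|0 - u|), (0, 0)|exists (`|0 + u| - 0); exact: (Lub (0, 0))].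
pose s := sup L.
have sL x : G x -> x.2 - `|x.1 - u| <= s.
  by move=> Gx; apply: ub_le_sup; [case: Lsup|exists x].
have sU x : G x -> s <= `|x.1 + u| - x.2.
  by move=> Gx; apply: ge_sup; [case: Lsup|exact: Lub].
have Gscale c x : G x -> G (c *: x.1, c * x.2).
  by move=> Gx; have := Glin c _ _ Gx G0; rewrite /= !addr0.
exists s, [set z | exists c x, G x /\ z = (x.1 + c *: u, x.2 + c * s)].
split; last first.
- by exists 1, (0, 0); rewrite /= scale1r mul1r !add0r.
- by move=> x Gx; exists 0, x; rewrite scale0r mul0r !addr0 -surjective_pairing.
split.
- move=> c _ _ [a [x [Gx ->]]] [b [y [Gy ->]]] /=.
  exists (c * a + b), (c *: x.1 + y.1, c * x.2 + y.2); split; first exact: Glin.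
  by rewrite /= scalerDr scalerDl scalerA; congr pair; [rewrite addrACA|ring].
- move=> _ [c [x [Gx ->]]] /=.
  (* Division by the absolute value of [c] reduces to the coefficients -1 and 1, which are covered
     by [sL] and [sU]. *)
  have [c0|c0|->] := ltgtP c 0.
  + have := sL _ (Gscale (- c)^-1 _ Gx) => /=.
    have -> : (- c)^-1 *: x.1 - u = (- c)^-1 *: (x.1 + c *: u).
      by rewrite scalerDr scalerA invrN mulNr mulVf ?lt_eqF// scaleN1r.
    rewrite normrZ gtr0_norm ?invr_gt0 ?oppr_gt0// -mulrBr.
    rewrite ler_pdivrMl ?oppr_gt0//; lra.
  + have := sU _ (Gscale c^-1 _ Gx) => /=.
    have -> : c^-1 *: x.1 + u = c^-1 *: (x.1 + c *: u).
      by rewrite scalerDr scalerA mulVf ?gt_eqF// scale1r.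
    rewrite normrZ gtr0_norm ?invr_gt0// -mulrBr ler_pdivlMl//; lra.
  + by rewrite scale0r mul0r !addr0; exact: Gdom.
Qed.

(* Zorn's lemma is applied to graphs that are empty or contain [(v, |v|)], so
   that the empty chain needs no separate treatment. *)
Lemma hahn_banach_norming (R : realType) (E : normedModType R) (v : E) :
  exists xs : E -> R, dual_ball xs /\ xs v = `|v|.
Proof.
pose P (G : set (E * R)) :=
  dominated_graph R E G /\ (G !=set0 -> G (v, `|v|)).
have [A [[[Alin Adom] Av] Amax]] : exists A, P A /\ forall B, A `<` B -> ~ P B.
  apply: Zorn_bigcup => F FP Ftot; split; first split.
  - move=> c x y [X FX Xx] [Y FY Yy].
    have [XY|YX] := Ftot _ _ FX FY.
      by exists Y => //; apply: (FP _ FY).1.1 => //; exact: XY.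
    by exists X => //; apply: (FP _ FX).1.1 => //; exact: YX.
  - by move=> x [X FX Xx]; exact: (FP _ FX).1.2.
  - by move=> [x [X FX Xx]]; exists X => //; apply: (FP _ FX).2; exists x.
(* An empty [A] would not be maximal, since the graph of [c *: v] mapped to [c * |v|] satisfies [P]
   and is nonempty. *)
have {}Av : A (v, `|v|).
  apply: Av; apply/set0P/eqP => A0.
  apply: (Amax [set (c *: v, c * `|v|) | c in setT]).
    rewrite A0; split => // /(_ (0 *: v, 0 * `|v|)); apply.
    by exists 0.
  split; last by move=> _; exists 1 => //; rewrite scale1r mul1r.
  split.
    move=> c _ _ [a _ <-] [b _ <-] /=; exists (c * a + b) => //.
    by rewrite scalerDl scalerA mulrDl mulrA.
  by move=> _ [c _ <-] /=; rewrite normrZ ler_wpM2r// ler_norm.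
have A0 : A (0, 0).
  by have := Alin (-1) _ _ Av Av; rewrite /= scaleN1r mulN1r !addNr.
have Auniq u a b : A (u, a) -> A (u, b) -> a = b.
  move=> Aa Ab; apply/eqP; rewrite eq_le.
  have := Adom _ (Alin (-1) _ _ Aa Ab); have := Adom _ (Alin (-1) _ _ Ab Aa).
  by rewrite /= !scaleN1r !addNr normr0 !mulN1r addrC subr_le0 addrC subr_le0 => -> ->.
have Atot u : exists a, A (u, a).
  have [s [H [Hdom AH Hu]]] := dominated_graph_extension R E A u (conj Alin Adom) A0.
  have [HA|HA] := pselect (H `<=` A); first by exists s; exact: HA.
  exfalso; apply: (Amax H); first by split.
  by split => // _; exact: AH.
pose xs u := xget 0 [set a | A (u, a)].
have Axs u : A (u, xs u) by rewrite /xs; case: xgetP => [a ->//|/(_ _)]; have [a Aa] := Atot u => /(_ a).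
have xslin (a : R) (u w : E) : xs (a *: u + w) = a * xs u + xs w.
  by apply: (Auniq (a *: u + w)) => //; exact: (Alin a _ _ (Axs u) (Axs w)).
have xs0 : xs 0 = 0 by apply: (Auniq 0).
have xsb u : `|xs u| <= `|u|.
  rewrite ler_norml; have := Adom _ (Axs u) => /= ->; rewrite andbT.
  have := Adom _ (Alin (-1) _ _ (Axs u) A0).
  by rewrite /= scaleN1r !addr0 normrN mulN1r lerNl.
exists xs; split; last by apply: (Auniq v).
split=> //; split=> // x; apply/cvgrPdist_le => e e0.
near=> y; rewrite -[xs x]opprK -opprD normrN addrC.
have -> : xs y - xs x = xs (y - x).
  by rewrite (_ : y - x = -1 *: x + y) ?xslin ?mulN1r 1?addrC// scaleN1r addrC.
by rewrite (le_trans (xsb _)) // distrC.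
Unshelve. all: by end_near. Qed.

(** A functional norming [u - v] vanishes there, so the norm of [u - v] is zero. *)
Lemma dual_separates (R : realType) (E : normedModType R) (u v : E) :
  (forall xs, dual xs -> xs u = xs v) -> u = v.
Proof.
move=> h; have [xs [[xsd _] xsE]] := hahn_banach_norming R E (u - v).
apply/eqP; rewrite -subr_eq0 -normr_eq0 -xsE.
have [xslin _] := xsd.
by rewrite addrC -scaleN1r xslin mulN1r h// addNr.
Qed.

Lemma dual0 (R : realType) (E : normedModType R) (xs : E -> R) : dual xs -> xs 0 = 0.
Proof.
by case=> xslin _; have := xslin (-1) 0 0; rewrite scaler0 addr0 mulN1r addNr.
Qed.

(** Continuity at 0 gives a radius [e] on which [xs] is at most 1; rescaling [u] to norm [e / 2]
    yields the constant [2 / e]. The bound allows any dual functional to be scaled into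
    [dual_ball]. *)
Lemma dual_bounded (R : realType) (E : normedModType R) (xs : E -> R) :
  dual xs -> exists2 C : R, 0 < C & forall u, `|xs u| <= C * `|u|.
Proof.
move=> dxs; have xs0 := dual0 _ _ _ dxs; have [xslin xscont] := dxs.
have xsZ a u : xs (a *: u) = a * xs u by have := xslin a u 0; rewrite xs0 !addr0.
have /cvgrPdist_le/(_ 1 ltr01) := xscont 0; rewrite xs0 => /nbhs_normP[e /= e0 he].
exists (2 / e); first by rewrite divr_gt0.
move=> u; have [->|u0] := eqVneq u 0; first by rewrite xs0 !normr0 mulr0.
have nu0 : 0 < `|u| by rewrite normr_gt0.
have scu : `|(e / (2 * `|u|)) *: u| < e.
  rewrite normrZ gtr0_norm ?divr_gt0 ?mulr_gt0//.
  have -> : e / (2 * `|u|) * `|u| = e / 2.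
    by rewrite -mulrA invfM -mulrA mulVf ?mulr1// gt_eqF.
  by rewrite ltr_pdivrMr// ltr_pMr// ltr1n.
have := he ((e / (2 * `|u|)) *: u); rewrite /ball_/= !sub0r !normrN => /(_ scu).
rewrite xsZ normrM gtr0_norm ?divr_gt0 ?mulr_gt0//.
rewrite mulrAC ler_pdivrMr ?mulr_gt0// mul1r => h.
by rewrite mulrAC ler_pdivlMr// mulrC.
Qed.

(** * Positive and negative variations *)

Section variation_measures.
Context {R : realType} {d : measure_display} {T : measurableType d}.
Implicit Types (D : set (set T)) (nu : set T -> R).

(** Abstracts the properties of [sigmaX]: an ideal of sets inside the sigma-algebra, in particular a
    delta-ring. *)
Definition measurable_ideal D : Prop :=
  [/\ D set0, D `<=` measurable,
      forall A B, D A -> D B -> D (A `|` B) &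
      forall A B, D A -> measurable B -> B `<=` A -> D B].

Definition sigma_additive_on D nu : Prop :=
  (forall A B, D A -> D B -> A `&` B = set0 -> nu (A `|` B) = nu A + nu B) /\
  (forall F : nat -> set T, (forall n, D (F n)) -> trivIset setT F ->
    D (\bigcup_n F n) ->
    (fun n => \sum_(i < n) nu (F i)) @ \oo --> nu (\bigcup_n F n)).

Lemma sigma_additive_on0 D nu : D set0 -> sigma_additive_on D nu -> nu set0 = 0.
Proof.
move=> D0 [/(_ _ _ D0 D0)]; rewrite setI0 setU0 => /(_ erefl) h _.
by apply: (addrI (nu set0)); rewrite -h addr0.
Qed.

Lemma sigma_additive_onN D nu :
  sigma_additive_on D nu -> sigma_additive_on D (fun A => - nu A).
Proof.
move=> [add sadd]; split=> [A B DA DB AB|F DF tF DUF]; first by rewrite add// opprD.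
under eq_fun do rewrite sumrN.
by apply: cvgN; exact: sadd.
Qed.

Lemma pos_var_le D nu (A B : set T) : D B -> B `<=` A ->
  ((nu B)%:E <= pos_var D nu A)%E.
Proof. by move=> DB BA; apply: ereal_sup_ubound; exists B. Qed.

(** For fixed finite [a], subtract [a] and take the supremum over [b]; then do the same in the other
    variable. Membership of 0 keeps both suprema nonnegative. *)
Lemma ereal_sup_add_le (S1 S2 : set (\bar R)) (c : \bar R) :
  S1 0%E -> S2 0%E -> (forall a, S1 a -> a \is a fin_num) ->
  (forall a b, S1 a -> S2 b -> (a + b <= c)%E) ->
  (ereal_sup S1 + ereal_sup S2 <= c)%E.
Proof.
move=> S10 S20 S1f h.
have s1 : (0 <= ereal_sup S1)%E by exact: ereal_sup_ubound.
have s2 : (0 <= ereal_sup S2)%E by exact: ereal_sup_ubound.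
have {}h a : S1 a -> (a + ereal_sup S2 <= c)%E.
  move=> Sa; rewrite addeC -leeBrDr ?S1f//; apply: ge_ereal_sup => b Sb.
  by rewrite leeBrDr ?S1f// addeC h.
(* For [c] below infinity, the choice [a = 0] bounds the second supremum by [c], so it is finite and
   can be subtracted. *)
have [->|cy] := eqVneq c +oo%E; first by rewrite leey.
have s2c : (ereal_sup S2 <= c)%E by rewrite -[leLHS]add0e h.
have s2f : ereal_sup S2 \is a fin_num.
  by rewrite ge0_fin_numE// (le_lt_trans s2c)// ltey.
rewrite -leeBrDr//; apply: ge_ereal_sup => a Sa.
by rewrite leeBrDr// h.
Qed.

Section pos_var_measure.
Context {D : set (set T)} {nu : set T -> R}.
Context (Did : measurable_ideal D) (nu_sadd : sigma_additive_on D nu).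

Let D0 : D set0. Proof. by case: Did. Qed.
Let nu0 : nu set0 = 0. Proof. exact: sigma_additive_on0 nu_sadd. Qed.

Lemma pos_var_ge0 A : (0 <= pos_var D nu A)%E.
Proof. by rewrite -[leLHS]/(0%:E) -nu0; exact: pos_var_le. Qed.

Lemma pos_var0 : pos_var D nu set0 = 0%E.
Proof.
apply/eqP; rewrite eq_le; apply/andP; split.
  by apply: ge_ereal_sup => _ [B [_ +] <-]; rewrite subset0 => ->; rewrite nu0.
exact: pos_var_ge0.
Qed.

Lemma pos_var_super A B : A `&` B = set0 ->
  (pos_var D nu A + pos_var D nu B <= pos_var D nu (A `|` B))%E.
Proof.
move=> AB0; apply: ereal_sup_add_le.
- by exists set0; [split|rewrite nu0].
- by exists set0; [split|rewrite nu0].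
- by move=> _ [C _ <-].
move=> _ _ [C [DC CA] <-] [C' [DC' CB] <-].
have CC0 : C `&` C' = set0.
  by rewrite -subset0 -AB0; exact: setISS.
case: nu_sadd => add _; rewrite -EFinD -add//.
apply: pos_var_le; last exact: setUSS.
by case: Did => _ _ DU _; exact: DU.
Qed.

Lemma pos_var_mono A B : A `<=` B -> (pos_var D nu A <= pos_var D nu B)%E.
Proof.
move=> AB; apply: ge_ereal_sup => _ [C [DC CA] <-].
by apply: pos_var_le => //; exact: subset_trans AB.
Qed.

Lemma pos_var_sum_le (F : nat -> set T) n : trivIset setT F ->
  (\sum_(0 <= i < n) pos_var D nu (F i) <= pos_var D nu (\big[setU/set0]_(i < n) F i))%E.
Proof.
move=> tF; elim: n => [|n IH]; first by rewrite big_nil pos_var_ge0.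
rewrite big_nat_recr//= big_ord_recr/=.
apply: le_trans (pos_var_super _ _ _); first exact: leeD2r.
rewrite -bigcup_mkord -subset0 => x [[k /= kn Fkx] Fnx].
have : F k `&` F n !=set0 by exists x.
by move=> /(tF _ _ I I) kn'; move: kn; rewrite kn' ltnn.
Qed.

(** The series is at most the value on the union by finite superadditivity and monotonicity.
    Conversely, a test set [B] in the union is cut along the [F n], and countable additivity of [nu]
    bounds [nu B] by the series. *)
Lemma pos_var_sigma_additive : semi_sigma_additive (pos_var D nu).
Proof.
move=> F mF tF mUF.
have -> : pos_var D nu (\bigcup_n F n) = (\sum_(0 <= i <oo) pos_var D nu (F i))%E.
  apply/eqP; rewrite eq_le; apply/andP; split; last first.
    apply: lime_le; first by apply: is_cvg_nneseries => *; exact: pos_var_ge0.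
    apply: nearW => n; apply: le_trans (pos_var_sum_le F n tF) _.
    by apply: pos_var_mono; rewrite -bigcup_mkord => x [i _ Fx]; exists i.
  apply: ge_ereal_sup => _ [B [DB BF] <-].
  have BE : B = \bigcup_n (B `&` F n) by rewrite -setI_bigcupr; apply/esym/setIidPl.
  have DBF n : D (B `&` F n).
    case: Did => _ mD _ Dsub; apply: (Dsub _ _ DB); last exact: subIsetl.
    by apply: measurableI => //; exact: mD.
  have tBF : trivIset setT (fun n => B `&` F n) by exact: trivIset_setIl.
  case: nu_sadd => _ /(_ _ DBF tBF); rewrite -BE => /(_ DB) cvg_nu.
  have cvgE : (fun n => (\sum_(i < n) nu (B `&` F i))%:E) @ \oo --> (nu B)%:E.
    by apply: cvg_EFin => //; exact: nearW.
  rewrite -(cvg_lim _ cvgE)//; apply: lee_lim.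
  - by apply/cvg_ex; exists (nu B)%:E.
  - by apply: is_cvg_nneseries => *; exact: pos_var_ge0.
  - apply: nearW => n; rewrite big_mkord -sumEFin; apply: lee_sum => i _.
    by apply: pos_var_le => //; exact: subIsetr.
by apply: is_cvg_nneseries => *; exact: pos_var_ge0.
Qed.

HB.instance Definition _ := isMeasure.Build _ _ _ (pos_var D nu)
  pos_var0 pos_var_ge0 pos_var_sigma_additive.

(** The measure structure depends on the two hypotheses on [D] and [nu]; later statements therefore
    take a bundled [p] together with this equation. *)
Lemma pos_var_measure :
  exists p : {measure set T -> \bar R}, p = pos_var D nu :> (set T -> \bar R).
Proof. by exists (pos_var D nu). Qed.

End pos_var_measure.

(** For the upper bound, the pieces of a family are grouped by the sign of [nu] into two sets [B]
    and [C]. For the lower bound, the common part of two test sets cancels in [nu B - nu C], leaving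
    the disjoint differences as a two-piece family. *)
Lemma variationE D nu A : measurable_ideal D -> sigma_additive_on D nu ->
  Defs.variation D nu A = (pos_var D nu A + neg_var D nu A)%E.
Proof.
move=> [D0 mD DU Dsub] nuS; have [add _] := nuS.
have nu0 := sigma_additive_on0 _ _ D0 nuS.
apply/eqP; rewrite eq_le; apply/andP; split.
  apply: ge_ereal_sup => _ [n [F [DF tF ->]]].
  have [B [C [DB BA DC CA]]] : exists B C, [/\ D B,
      B `<=` \bigcup_(i < n) F i, D C, C `<=` \bigcup_(i < n) F i &
      \sum_(i < n) `|nu (F i)| = nu B - nu C].
    elim: n DF tF => [|n IH] DF tF.
      by exists set0, set0; rewrite big_ord0 nu0 subr0; split.
    have [||B [C [DB BF DC CF E]]] := IH.
    - by move=> i ni; apply: DF; rewrite ltnS ltnW.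
    - by apply: sub_trivIset tF => i /= ni; rewrite ltnS ltnW.
    have [DFn _] := DF n (ltnSn n).
    have sub : \bigcup_(i < n) F i `<=` \bigcup_(i < n.+1) F i.
      by move=> x [i /= ni Fix]; exists i => //=; rewrite ltnS ltnW.
    have subn : F n `<=` \bigcup_(i < n.+1) F i by move=> x ?; exists n => /=.
    have dis G : G `<=` \bigcup_(i < n) F i -> G `&` F n = set0.
      move=> GF; rewrite -subset0 => x [/GF [i /= ni Fix] Fnx].
      have : F i `&` F n !=set0 by exists x.
      move=> /(tF _ _ _ _) -/(_ (ltnW ni) (ltnSn n)) in_.
      by move: ni; rewrite in_ ltnn.
    have [h|h] := leP 0 (nu (F n)).
      exists (B `|` F n), C; split => //.
      - exact: DU.
      - by move=> x [/BF/sub|/subn].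
      - exact: subset_trans sub.
      - by rewrite big_ord_recr/= E ger0_norm// add ?dis// addrAC.
    exists B, (C `|` F n); split => //.
    - exact: subset_trans sub.
    - exact: DU.
    - by move=> x [/CF/sub|/subn].
    - by rewrite big_ord_recr/= E ltr0_norm// add ?dis// opprD addrA.
  move=> ->.
  have FA : \bigcup_(i < n) F i `<=` A by apply: bigcup_sub => i /= /DF[].
  rewrite EFinD; apply: leeD; apply: ereal_sup_ubound.
    by exists B => //; split => //; exact: subset_trans FA.
  by exists C => //; split => //; exact: subset_trans FA.
apply: ereal_sup_add_le.
- by exists set0; [split|rewrite nu0].
- by exists set0; [split|rewrite nu0 oppr0].
- by move=> _ [C _ <-].
move=> _ _ [B [DB BA] <-] [C [DC CA] <-].
have DBC X Y : D X -> D Y -> D (X `\` Y).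
  move=> DX DY; apply: (Dsub _ _ DX); last exact: subDsetl.
  by apply: measurableD; exact: mD.
have DI X Y : D X -> D Y -> D (X `&` Y).
  move=> DX DY; apply: (Dsub _ _ DX); last exact: subIsetl.
  by apply: measurableI; exact: mD.
have nuD X Y : D X -> D Y -> nu X = nu (X `\` Y) + nu (X `&` Y).
  move=> DX DY; rewrite -add; [by rewrite setUC setUIDK|exact: DBC|exact: DI|].
  by rewrite -subset0 => x [[_ nY] [_ /nY]].
apply: (@le_trans _ _ (`|nu (B `\` C)| + `|nu (C `\` B)|)%:E).
  rewrite -EFinD lee_fin (nuD B C)// (nuD C B)// (setIC C B).
  have := ler_norm (nu (B `\` C)); have := ler_norm (- nu (C `\` B)).
  rewrite normrN; lra.
apply: ereal_sup_ubound; exists 2%N, (fun i => if i == 0%N then B `\` C else C `\` B).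
split.
- move=> [|[|//]] _ /=; (split; first exact: DBC); first by move=> x [/BA].
  by move=> x [/CA].
- move=> [|[|//]] [|[|//]] _ _ //= [x [[? ?] [? ?]]] //.
- by rewrite !big_ord_recr big_ord0/= add0r.
Qed.

End variation_measures.

(** * Hahn decomposition for a set function on an ideal of sets *)

Section hahn_on_ideal.
Context {R : realType} {d : measure_display} {T : measurableType d}.
Context {D : set (set T)} {nu : set T -> R}.
Context (Did : measurable_ideal D) (nu_sadd : sigma_additive_on D nu).

Section charge_on.
Context (F : set T) (DF : D F).

(** Intersecting with a fixed [F] in [D] makes [nu] a finite charge on the whole sigma-algebra, to
    which the Hahn decomposition of charges applies. *)
Definition charge_on (A : set T) : \bar R := (nu (A `&` F))%:E.

Let DI A : measurable A -> D (A `&` F).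
Proof.
move=> mA; case: Did => _ mD _ Dsub; apply: (Dsub _ _ DF); last exact: subIsetr.
by apply: measurableI => //; exact: mD.
Qed.

Let charge_on0 : charge_on set0 = 0%E.
Proof.
by rewrite /charge_on set0I; case: Did => D0 _ _ _; rewrite (sigma_additive_on0 _ _ D0).
Qed.

Let charge_on_fin A : measurable A -> charge_on A \is a fin_num.
Proof. by []. Qed.

Let charge_on_sigma_additive : semi_sigma_additive charge_on.
Proof.
move=> G mG tG mUG; rewrite /charge_on setI_bigcupl.
case: nu_sadd => _ /(_ (fun n => G n `&` F)) sadd.
under eq_fun do rewrite sumEFin big_mkord.
apply: cvg_EFin; first exact: nearW.
apply: sadd; first by move=> n; exact: DI.
- exact: trivIset_setIr.
- by rewrite -setI_bigcupl; exact: DI.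
Qed.

HB.instance Definition _ := isCharge.Build _ _ _ charge_on
  charge_on0 charge_on_fin charge_on_sigma_additive.

Lemma hahn_on_set : exists P : set T, [/\ measurable P,
  forall B, measurable B -> B `<=` P `&` F -> 0 <= nu B &
  forall B, measurable B -> B `<=` F `\` P -> nu B <= 0].
Proof.
have [P [N [[mP Ppos] [mN Nneg] PN _]]] := Hahn_decomposition charge_on.
exists P; split=> // B mB BF.
- have := Ppos B mB (subset_trans BF (@subIsetl _ _ _)).
  by rewrite /= /charge_on (_ : B `&` F = B) ?lee_fin//; apply/setIidPl => x /BF[].
- have /(Nneg B mB) : B `<=` N.
    by move=> x /BF[_ nPx]; have : [set: T] x by []; rewrite -PN => -[].
  by rewrite /= /charge_on (_ : B `&` F = B) ?lee_fin//; apply/setIidPl => x /BF[].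
Qed.

End charge_on.

(* The Hahn decompositions of the restrictions of [nu] to the pieces of a
   disjoint cover are glued together; [nu] itself need not be finite. *)
Lemma hahn_on_ideal (Om : nat -> set T) :
  (forall n, D (Om n)) -> \bigcup_n Om n = setT ->
  exists P : set T, [/\ measurable P,
    forall B, D B -> B `<=` P -> 0 <= nu B &
    forall B, D B -> B `<=` ~` P -> nu B <= 0].
Proof.
move=> DOm cover; pose F := seqDU Om.
have [_ mD _ Dsub] := Did.
have mF n : measurable (F n).
  by apply: measurableD; [exact: mD|apply: bigsetU_measurable => i _; exact: mD].
have DF n : D (F n) by apply: (Dsub _ _ (DOm n)) => //; exact: subDsetl.
have FT : \bigcup_n F n = setT by rewrite -seqDU_bigcup_eq.
have tF : trivIset setT F by exact: trivIset_seqDU.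
have /choice[P hP] n := hahn_on_set (F n) (DF n).
have DBF B n : D B -> D (B `&` F n).
  move=> DB; apply: (Dsub _ _ DB); last exact: subIsetl.
  by apply: measurableI => //; exact: mD.
(* Countable additivity recovers [nu B] from its pieces, so a sign that holds on every piece passes
   to the limit. *)
have nu_lim B : D B -> (fun n => \sum_(i < n) nu (B `&` F i)) @ \oo --> nu B.
  move=> DB; have BE : \bigcup_n (B `&` F n) = B by rewrite -setI_bigcupr FT setIT.
  rewrite -[X in _ --> nu X]BE; case: nu_sadd => _; apply.
  - by move=> n; exact: DBF.
  - exact: trivIset_setIl.
  - by rewrite BE.
exists (\bigcup_n (P n `&` F n)); split.
- by apply: bigcupT_measurable => n; apply: measurableI => //; case: (hP n).
- move=> B DB BP; rewrite -(cvg_lim _ (nu_lim B DB))//.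
  apply: limr_ge; first by apply/cvg_ex; exists (nu B); exact: nu_lim.
  apply: nearW => n; apply: sumr_ge0 => i _.
  have [_ + _] := hP i; apply; first exact/mD/DBF.
  move=> x [/BP[j _ [Pjx Fjx]] Fix]; split=> //.
  have : F i `&` F j !=set0 by exists x.
  by move=> /(tF _ _ I I) ->.
- move=> B DB BP; rewrite -(cvg_lim _ (nu_lim B DB))//.
  apply: limr_le; first by apply/cvg_ex; exists (nu B); exact: nu_lim.
  apply: nearW => n; apply: sumr_le0 => i _.
  have [_ _] := hP i; apply; first exact/mD/DBF.
  move=> x [Bx Fix]; split=> // Pix; apply: (BP x Bx).
  by exists i.
Qed.

(** The supremum is attained at the intersection of [A] with [P]: a test set [B] only gains by
    dropping its part outside [P] and by adding the rest of that intersection. *)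
Lemma pos_var_hahn (P A : set T) : measurable P ->
  (forall B, D B -> B `<=` P -> 0 <= nu B) ->
  (forall B, D B -> B `<=` ~` P -> nu B <= 0) ->
  D A -> pos_var D nu A = (nu (A `&` P))%:E.
Proof.
move=> mP Ppos Pneg DA.
have [_ mD _ Dsub] := Did; have [add _] := nu_sadd.
have Dhered B C : D B -> measurable C -> C `<=` B -> D C by move=> DB; exact: Dsub.
have nuE B C : D B -> measurable C -> nu B = nu (B `&` C) + nu (B `\` C).
  move=> DB mC; have mB := mD _ DB; rewrite -add ?setUIDK//.
  - by apply: (Dhered B); [|exact: measurableI|exact: subIsetl].
  - by apply: (Dhered B); [|exact: measurableD|exact: subDsetl].
  - by rewrite -subset0 => x [[_ ?] []].
have DIP B : D B -> D (B `&` P).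
  by move=> DB; apply: (Dhered B) => //; apply: measurableI => //; exact: mD.
apply/eqP; rewrite eq_le; apply/andP; split; last first.
  by apply: pos_var_le; [exact: DIP|exact: subIsetl].
apply: ge_ereal_sup => _ [B [DB BA] <-]; rewrite lee_fin.
have nuBP : nu (B `\` P) <= 0.
  apply: Pneg; last by move=> x [].
  by apply: (Dhered B) => //; apply: measurableD => //; exact: mD.
have nuAB : 0 <= nu ((A `&` P) `\` B).
  apply: Ppos; last by move=> x [[]].
  apply: (Dhered A) => //; last by move=> x [[]].
  by apply: measurableD; [apply: measurableI => //|]; exact: mD.
rewrite (nuE B P)// (nuE (A `&` P) B); [|exact: DIP|exact: mD].
have -> : A `&` P `&` B = B `&` P by rewrite setIAC; congr (_ `&` _); apply/setIidPr.
lra.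
Qed.

End hahn_on_ideal.

(** * Scalar functionals continuous along increasing sequences *)

Section monotone_continuous_functional.
Context {R : realType} {d : measure_display} {T : measurableType d}.

(** The pointwise weakening of [ideal_fs]. It mentions no measure, so the scalar argument applies
    uniformly to spaces over [mu] and over [xi]. *)
Definition solid_space (Z : set (T -> R)) : Prop :=
  [/\ forall f, Z f -> measurable_fun setT f,
      Z (fun=> 0),
      forall (a : R) f g, Z f -> Z g -> Z (fun x => a * f x + g x) &
      forall f (g : T -> R), Z f -> measurable_fun setT g ->
        (forall x, `|g x| <= `|f x|) -> Z g].

Definition monotone_continuous (Z : set (T -> R)) (phi : (T -> R) -> R) : Prop :=
  (forall (a : R) f g, Z f -> Z g ->
    phi (fun x => a * f x + g x) = a * phi f + phi g) /\
  (forall (fn : nat -> T -> R) f, (forall n, Z (fn n)) -> Z f ->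
    (forall n x, 0 <= fn n x) -> (forall x, nondecreasing_seq (fn ^~ x)) ->
    (forall x, fn ^~ x @ \oo --> f x) ->
    (fun n => phi (fn n)) @ \oo --> phi f).

Lemma monotone_continuousN Z phi :
  monotone_continuous Z phi -> monotone_continuous Z (fun f => - phi f).
Proof.
move=> [lin cont]; split=> [a f g Zf Zg|fn f Zfn Zf fn0 nd cv].
  by rewrite lin// opprD mulrN.
by apply: cvgN; exact: cont.
Qed.

Context {Z : set (T -> R)} {phi : (T -> R) -> R}.
Context (Zsolid : solid_space Z) (phiZ : monotone_continuous Z phi).

Lemma solid_restrict (A : set T) f : measurable A -> Z f -> Z (f \_ A).
Proof.
move=> mA Zf; have [mZ _ _ sol] := Zsolid; apply: (sol f) => //.
  by rewrite patch_indic; apply: measurable_funM; [exact: mZ|exact: measurable_indic].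
by move=> x; rewrite patchE; case: ifP; rewrite ?normr0.
Qed.

Lemma functional0 : phi (fun=> 0) = 0.
Proof.
have [_ Z0 _ _] := Zsolid; have [lin _] := phiZ.
have phi0 : phi (fun=> 0) = -1 * phi (fun=> 0) + phi (fun=> 0).
  by rewrite -lin//; congr phi; apply/funext => x; rewrite mulr0 addr0.
by rewrite phi0 mulN1r addNr.
Qed.

Lemma functional_scale (a : R) f : Z f -> phi (fun x => a * f x) = a * phi f.
Proof.
move=> Zf; have [_ Z0 _ _] := Zsolid; have [lin _] := phiZ.
have := lin a _ _ Zf Z0; rewrite functional0 addr0 => <-.
by congr phi; apply/funext => x; rewrite addr0.
Qed.

Lemma functional_add f g : Z f -> Z g -> phi (f \+ g) = phi f + phi g.
Proof.
move=> Zf Zg; have [lin _] := phiZ; have := lin 1 _ _ Zf Zg; rewrite mul1r => <-.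
by congr phi; apply/funext => x; rewrite mul1r.
Qed.

Lemma functional_split (A : set T) f : measurable A -> Z f ->
  phi f = phi (f \_ A) + phi (f \_ (~` A)).
Proof.
move=> mA Zf; rewrite -functional_add; [|exact: solid_restrict|].
  congr phi; apply/funext => x /=; rewrite !patchE in_setC.
  by case: (x \in A); rewrite /= ?addr0 ?add0r.
by apply: solid_restrict => //; exact: measurableC.
Qed.

Lemma functional_sum (I : Type) (s : seq I) (F : I -> T -> R) :
  (forall i, Z (F i)) ->
  Z (fun x => \sum_(i <- s) F i x) /\
  phi (fun x => \sum_(i <- s) F i x) = \sum_(i <- s) phi (F i).
Proof.
move=> ZF; have [_ Z0 Zlin _] := Zsolid; have [lin _] := phiZ.
elim: s => [|i s [Zs IH]].
  under eq_fun do rewrite big_nil; rewrite big_nil functional0; split=> //.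
have -> : (fun x => \sum_(j <- i :: s) F j x) =
          (fun x => 1 * F i x + \sum_(j <- s) F j x).
  by apply/funext => x; rewrite big_cons mul1r.
by rewrite big_cons lin// mul1r IH; split=> //; exact: Zlin.
Qed.

Context {D : set (set T)} {nu : set T -> R}.
Context (Did : measurable_ideal D) (DZ : forall A, D A -> Z \1_A).
Context (nuE : forall A, D A -> nu A = phi \1_A).

(** The indicators of the partial unions increase pointwise to the indicator of the full union, and
    [phi] is continuous along this sequence. *)
Lemma functional_sigma_additive : sigma_additive_on D nu.
Proof.
have [D0 mD DU Dsub] := Did; have [lin cont] := phiZ.
have add A B : D A -> D B -> A `&` B = set0 -> nu (A `|` B) = nu A + nu B.
  move=> DA DB AB; rewrite !nuE//; last exact: DU.
  rewrite -functional_add; [|exact: DZ|exact: DZ].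
  congr phi; apply/funext => x /=.
  rewrite !indicE in_setU.
  have : x \notin A `&` B by rewrite AB in_set0.
  by rewrite in_setI; case: (x \in A); case: (x \in B); rewrite //= ?addr0 ?add0r.
split=> // F DF tF DUF.
have DUn n : D (\big[setU/set0]_(i < n) F i).
  by elim: n => [|n IH]; rewrite ?big_ord0// big_ord_recr; exact: DU.
have nu_sum n : \sum_(i < n) nu (F i) = nu (\big[setU/set0]_(i < n) F i).
  elim: n => [|n IH].
    rewrite !big_ord0 nuE// -functional0; congr phi.
    by apply/funext => x; rewrite indicE in_set0.
  rewrite !big_ord_recr/= add; [by rewrite IH|exact: DUn|exact: DF|].
  rewrite -bigcup_mkord -subset0 => x [[k /= kn Fkx] Fnx].
  have : F k `&` F n !=set0 by exists x.
  by move=> /(tF _ _ I I) kn'; move: kn; rewrite kn' ltnn.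
under eq_fun do rewrite nu_sum (nuE _ (DUn _)).
rewrite nuE//; apply: cont => [n||n x|x|x].
- exact: DZ.
- exact: DZ.
- by rewrite indicE.
- move=> m n mn; rewrite !indicE ler_nat.
  case: (boolP (x \in _)) => // /set_mem.
  rewrite -bigcup_mkord => -[i /= im Fix]; rewrite mem_set//.
  by rewrite -bigcup_mkord; exists i => //=; exact: leq_trans mn.
- apply: cvg_near_cst.
  have [[k _ Fkx]|nx] := pselect ((\bigcup_n F n) x).
    (* The partial union of index [n] runs over [i < n], so a point of [F k] belongs to it from
       [k.+1] on. *)
    exists k.+1 => // n /= kn; rewrite !indicE !mem_set//; first by exists k.
    by rewrite -bigcup_mkord; exists k.
  apply: nearW => n; rewrite !indicE !memNset//.
  by rewrite -bigcup_mkord => -[k _ ?]; apply: nx; exists k.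
Qed.

End monotone_continuous_functional.

(** * Integral representation of scalar functionals *)

Section integral_representation.
Context {R : realType} {d : measure_display} {T : measurableType d}.
Context {Z : set (T -> R)} {phi : (T -> R) -> R}.
Context (Zsolid : solid_space Z) (phiZ : monotone_continuous Z phi).
Context {D : set (set T)} {nu : set T -> R}.
Context (Did : measurable_ideal D) (DZ : forall A, D A -> Z \1_A).
Context (nuE : forall A, D A -> nu A = phi \1_A).
Context {P : set T} (mP : measurable P)
  (Ppos : forall B, D B -> B `<=` P -> 0 <= nu B)
  (Pneg : forall B, D B -> B `<=` ~` P -> nu B <= 0).
Context {p : {measure set T -> \bar R}} (pE : p = pos_var D nu :> (set T -> \bar R)).

Import HBNNSimple.

(** Since [h] vanishes off [U], its nonzero level sets lie in [D], where [pos_var_hahn] expresses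
    [p] through [phi]; linearity sums the levels. *)
Lemma sintegral_pos_var (h : {nnsfun T >-> R}) (U : set T) :
  D U -> (forall x, ~ U x -> h x = 0) ->
  sintegral p h = (phi (h \_ P))%:E.
Proof.
move=> DU hU; have [_ mD _ Dsub] := Did; have [_ Z0 _ _] := Zsolid.
have nuS := functional_sigma_additive Zsolid phiZ Did DZ nuE.
have Dlevel r : r != 0 -> D (h @^-1` [set r]).
  move=> r0; apply: (Dsub _ _ DU) => // x /= hxr.
  by apply: contrapT => /hU hx0; move: r0; rewrite -hxr hx0 eqxx.
pose F (r : R) (x : T) := r * (\1_(h @^-1` [set r] `&` P) x).
have ZF r : Z (F r).
  have [->|r0] := eqVneq r 0.
    by rewrite (_ : F 0 = fun=> 0)//; apply/funext => x; rewrite /F mul0r.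
  have [_ _ Zlin _] := Zsolid.
  have ZrP : Z \1_(h @^-1` [set r] `&` P).
    apply: DZ; apply: (Dsub _ _ (Dlevel _ r0)); last exact: subIsetl.
    exact: measurableI.
  have := Zlin r _ _ ZrP Z0; congr (Z _); apply/funext => x.
  by rewrite addr0.
have -> : h \_ P = (fun x => \sum_(r <- finmap.enum_fset (fset_set (range h))) F r x).
  apply/funext => x; rewrite patch_indic/= [h x]fimfunE fsbig_finite//=.
  by rewrite mulr_suml; apply: eq_bigr => r _; rewrite /F indicI mulrA.
have [_ ->] := functional_sum Zsolid phiZ _ (finmap.enum_fset (fset_set (range h))) F ZF.
rewrite sintegralE fsbig_finite//= -sumEFin; apply: eq_bigr => r _.
(* The zero level set may lie outside [D] and have infinite measure; its term is still 0 because
   [0 * +oo = 0]. *)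
have [->|r0] := eqVneq r 0.
  rewrite mul0e (_ : F 0 = fun=> 0) ?(functional0 Zsolid phiZ)//.
  by apply/funext => x; rewrite /F mul0r.
have DrP : D (h @^-1` [set r] `&` P).
  apply: (Dsub _ _ (Dlevel _ r0)); last exact: subIsetl.
  exact: measurableI.
rewrite pE (pos_var_hahn Did nuS P _ mP Ppos Pneg (Dlevel _ r0)).
by rewrite (functional_scale Zsolid phiZ)//; [rewrite -nuE|exact: DZ].
Qed.

Context {Om : nat -> set T} (DOm : forall n, D (Om n))
  (Om_cover : \bigcup_n Om n = setT).

(* [g] is approximated by simple functions cut off to finite unions of the
   [Om n], whose level sets lie in [D]. *)
Lemma ge0_integral_pos_var g : Z g -> (forall x, 0 <= g x) ->
  (\int[p]_x (g x)%:E = (phi (g \_ P))%:E)%E.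
Proof.
move=> Zg g0; have [D0 mD DU Dsub] := Did; have [mZ Z0 _ sol] := Zsolid.
have mg : measurable_fun setT (EFin \o g) by apply/measurable_EFinP; exact: mZ.
pose U n := \big[setU/set0]_(i < n) Om i.
have DUn n : D (U n).
  by elim: n => [|n IH]; rewrite /U ?big_ord0// big_ord_recr; exact: DU.
have Umono m n : (m <= n)%N -> U m `<=` U n.
  move=> mn; rewrite /U -!bigcup_mkord => x [i /= im Ox].
  by exists i => //=; exact: leq_trans mn.
pose a := nnsfun_approx measurableT mg.
pose h n := mul_nnsfun (a n) (indic_nnsfun R (mD _ (DUn n))).
have hE n x : h n x = a n x * \1_(U n) x by [].
have and_ x : nondecreasing_seq (fun n => a n x).
  by move=> m n mn; have /lefP := nd_nnsfun_approx measurableT mg mn; exact.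
have a_cvg x : (fun n => a n x) @ \oo --> g x.
  have /fine_cvgP[_] := cvg_nnsfun_approx measurableT mg
    (fun x _ => g0 x : (0 <= (EFin \o g) x)%E) (I : [set: T] x).
  exact.
have hnd x : nondecreasing_seq (fun n => h n x).
  move=> m n mn; rewrite !hE; apply: ler_pM => //; first exact: and_.
  rewrite !indicE ler_nat; case: (boolP (x \in U m)) => // /set_mem Ux.
  by rewrite mem_set//; exact: Umono Ux.
(* Every [x] lies in some [Om k], so the cutoff factor is eventually 1 and the limit of the
   approximation is unchanged. *)
have h_cvg x : (fun n => h n x) @ \oo --> g x.
  rewrite -[g x]mulr1; apply: cvgM; first exact: a_cvg.
  apply: cvg_near_cst; have : [set: T] x by [].
  rewrite -Om_cover => -[k _ Okx]; exists k.+1 => // n /= kn.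
  by rewrite -[LHS]/(\1_(U n) x) indicE mem_set//= /U -bigcup_mkord; exists k.
have hg n x : h n x <= g x.
  have hcv : cvgn (fun n => h n x) by apply/cvg_ex; exists (g x); exact: h_cvg.
  by rewrite -(cvg_lim _ (h_cvg x))//; exact: nondecreasing_cvgn_le.
have Zh n : Z (h n).
  by apply: (sol g) => // x; rewrite !ger0_norm.
have h_cvgE x : EFin \o (h ^~ x) @ \oo --> (g x)%:E.
  by apply: cvg_EFin; [exact: nearW|exact: h_cvg].
rewrite (nd_ge0_integral_lim p _ hnd h_cvgE)//.
have -> : sintegral p \o (fun n => h n) = fun n => (phi (h n \_ P))%:E.
  apply/funext => n /=; apply: sintegral_pos_var (DUn n) _ => x nUx.
  by rewrite hE indicE memNset// mulr0.
apply: cvg_lim => //; apply: cvg_EFin; first exact: nearW.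
(* Monotone convergence handled the integrals; the values of [phi] converge because the cut-off
   approximations restricted to [P] increase to [g] restricted to [P]. *)
have [_ cont] := phiZ; apply: cont => [n||n x|x m n mn|x].
- exact: solid_restrict.
- exact: solid_restrict.
- by rewrite patchE; case: ifP.
- by rewrite !patchE; case: ifP => // _; exact: hnd.
- under eq_fun do rewrite patchE; rewrite patchE.
  by case: ifP => _; [exact: h_cvg|exact: cvg_cst].
Qed.

(** Solidity puts the positive and negative parts of the restricted function in [Z]; the nonnegative
    case applies to each, and linearity of [phi] recombines them. *)
Lemma integral_pos_var g (A : set T) : Z g -> measurable A ->
  (\int[p]_(x in A) (g x)%:E = (phi ((g \_ A) \_ P))%:E)%E.
Proof.
move=> Zg mA; have [mZ _ _ sol] := Zsolid; have [lin _] := phiZ.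
pose f := g \_ A.
have Zf : Z f by exact: solid_restrict.
have Zpos : Z f^\+.
  apply: (sol f) => //; first by apply: measurable_funrpos; exact: mZ.
  by move=> x; rewrite -[leRHS]/((Num.norm \o f) x) -funrposDneg ger0_norm// lerDl.
have Zneg : Z f^\-.
  apply: (sol f) => //; first by apply: measurable_funrneg; exact: mZ.
  by move=> x; rewrite -[leRHS]/((Num.norm \o f) x) -funrposDneg ger0_norm// lerDr.
rewrite integral_mkcond restrict_EFin integralE funerpos funerneg.
rewrite !ge0_integral_pos_var// -EFinB; congr EFin.
have ZPpos : Z (f^\+ \_ P) by exact: solid_restrict.
have ZPneg : Z (f^\- \_ P) by exact: solid_restrict.
rewrite addrC -mulN1r -lin//; congr phi; apply/funext => x.
rewrite ![(_ \_ P) x]patchE; case: ifP => _; last by rewrite mulr0 addr0.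
by rewrite mulN1r addrC; exact: (congr1 (@^~ x) (funrposBneg f)).
Qed.

Lemma integral_abs_pos_var_lty g : Z g -> (\int[p]_x (`|g x|)%:E < +oo)%E.
Proof.
move=> Zg; have [mZ _ _ sol] := Zsolid.
rewrite (ge0_integral_pos_var (fun x => `|g x|)) ?ltry//.
apply: (sol g) => //; last by move=> x; rewrite normr_id.
by apply: measurableT_comp => //; exact: mZ.
Qed.

End integral_representation.

(** * Integrals against both variations of a scalar set function *)

Section scalar_representation.
Context {R : realType} {d : measure_display} {T : measurableType d}.
Context {Z : set (T -> R)} {phi : (T -> R) -> R}.
Context {D : set (set T)} {nu : set T -> R} {Om : nat -> set T}.

Lemma variation_measures : measurable_ideal D -> sigma_additive_on D nu ->
  exists p q : {measure set T -> \bar R},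
    [/\ p = pos_var D nu :> (set T -> \bar R),
        q = neg_var D nu :> (set T -> \bar R) &
        Defs.variation D nu = measure_add p q].
Proof.
move=> Did nuS.
have [p pE] := pos_var_measure Did nuS.
(* [neg_var D nu] unfolds to [pos_var] of the opposite set function. *)
have [q qE] := pos_var_measure Did (sigma_additive_onN _ _ nuS).
exists p, q; split=> //; apply/funext => A.
by rewrite measure_addE pE qE variationE.
Qed.

(** The positive variation is treated with [phi] and [P], the negative one with [- phi] and the
    complement of [P]. Their difference adds the values of [phi] on the two halves of [g] restricted
    to [A]. *)
Lemma sint_representation :
  solid_space Z -> monotone_continuous Z phi ->
  measurable_ideal D -> (forall A, D A -> Z \1_A) ->
  (forall A, D A -> nu A = phi \1_A) ->
  (forall n, D (Om n)) -> \bigcup_n Om n = setT ->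
  forall g, Z g ->
    (\int[Defs.variation D nu]_x (`|g x|)%:E < +oo)%E /\
    forall A, measurable A -> sint D nu A g = (phi (g \_ A))%:E.
Proof.
move=> Zsolid phiZ Did DZ nuE DOm Om_cover g Zg.
have nuS := functional_sigma_additive Zsolid phiZ Did DZ nuE.
have [P [mP Ppos Pneg]] := hahn_on_ideal Did nuS Om DOm Om_cover.
have mPC := measurableC mP.
have phiNZ := monotone_continuousN _ _ phiZ.
have nuNE A : D A -> - nu A = - phi \1_A by move=> DA; rewrite nuE.
have PCpos B : D B -> B `<=` ~` P -> 0 <= - nu B.
  by move=> DB BP; rewrite oppr_ge0 Pneg.
have PCneg B : D B -> B `<=` ~` ~` P -> - nu B <= 0.
  by rewrite setCK => DB BP; rewrite oppr_le0 Ppos.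
have [p [q [pE qE vE]]] := variation_measures Did nuS.
have mg : measurable_fun setT g by case: Zsolid => mZ _ _ _; exact: mZ.
split.
  rewrite vE ge0_integral_measure_add//; last first.
    by apply/measurable_EFinP; exact: measurableT_comp.
  rewrite lte_add_pinfty//.
    exact: (integral_abs_pos_var_lty Zsolid phiZ Did DZ nuE mP Ppos Pneg pE DOm).
  exact: (integral_abs_pos_var_lty Zsolid phiNZ Did DZ nuNE mPC PCpos PCneg qE DOm).
move=> A mA; rewrite /sint -pE -qE.
rewrite (integral_pos_var Zsolid phiZ Did DZ nuE mP Ppos Pneg pE DOm)//.
rewrite (integral_pos_var Zsolid phiNZ Did DZ nuNE mPC PCpos PCneg qE DOm)//.
rewrite -EFinB opprK; congr EFin; apply/esym.
by apply: (functional_split Zsolid phiZ) => //; exact: solid_restrict.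
Qed.

End scalar_representation.

(** * Vector integrals *)

Section vector_valued.
Context {R : realType} {d : measure_display} {T : measurableType d}.
Context {E : normedModType R}.

Lemma ae_wrt_all (lam : {measure set T -> \bar R}) (Q : T -> Prop) :
  (forall x, Q x) -> ae_wrt lam Q.
Proof.
by move=> h; exists set0; split=> // x /= /(_ (h x)).
Qed.

Lemma ideal_fs_solid (lam : {measure set T -> \bar R}) (Y : set (T -> R)) :
  ideal_fs lam Y -> solid_space Y.
Proof.
move=> [mY Y0 Ylin sol]; split=> // f g Yf mg fg.
by apply: (sol f) => //; exact: ae_wrt_all.
Qed.

Lemma dual_monotone_continuous (lam : {measure set T -> \bar R})
    (Y : set (T -> R)) (S : (T -> R) -> E) (xs : E -> R) :
  lin_op lam Y S -> order_w_cont lam Y S -> dual xs ->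
  monotone_continuous Y (xs \o S).
Proof.
move=> [Slin _] Scont dxs; split=> [a f g Yf Yg|fn f Yfn Yf fn0 nd cv].
  by case: dxs => xslin _; rewrite /= Slin// xslin.
by apply: Scont => //; apply: ae_wrt_all => x; split.
Qed.

Lemma sigmaX_ideal (lam : {measure set T -> \bar R}) (Y : set (T -> R)) :
  ideal_fs lam Y -> measurable_ideal (sigmaX Y).
Proof.
move=> /ideal_fs_solid[mY Y0 Ylin sol]; split.
- split=> //; rewrite (_ : \1_set0 = fun=> 0)//.
  by apply/funext => x; rewrite indicE in_set0.
- by move=> A [].
- move=> A B [mA YA] [mB YB]; split; first exact: measurableU.
  apply: (sol _ _ (Ylin 1 _ _ YA YB)).
    by apply: measurable_indic; exact: measurableU.
  move=> x; rewrite !indicE in_setU mul1r -natrD !normr_nat ler_nat.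
  by case: (x \in A); case: (x \in B).
- move=> A B [mA YA] mB BA; split=> //; apply: (sol _ _ YA).
    exact: measurable_indic.
  move=> x; rewrite !indicE; case: (boolP (x \in B)) => xB; last by rewrite normr0.
  by rewrite (mem_set (BA _ (set_mem xB))).
Qed.

(** The dual separates points; hence the choice made by [xget] in [Ivint] is canonical whenever an
    integral exists. *)
Lemma is_vint_inj (D : set (set T)) (m : set T -> E) A f u v :
  is_vint D m A f u -> is_vint D m A f v -> u = v.
Proof.
move=> hu hv; apply: dual_separates => xs dxs.
by apply: EFin_inj; rewrite hu// hv.
Qed.

Lemma IvintE (D : set (set T)) (m : set T -> E) f v :
  is_vint D m setT f v -> Ivint D m f = v.
Proof. by move=> hv; apply: xget_unique => // w hw; exact: is_vint_inj hw hv. Qed.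

Lemma L1v_Ivint (D : set (set T)) (m : set T -> E) f :
  L1v D m f -> is_vint D m setT f (Ivint D m f).
Proof. by move=> [_ _ /(_ _ measurableT)[v hv]]; rewrite (IvintE _ _ _ _ hv). Qed.

(** Inside a [lam]-null set every indicator is a.e. zero, so [S] sends it to 0 and all variation
    sums vanish. *)
Lemma semivar_abs_cont (lam : {measure set T -> \bar R}) (Y : set (T -> R))
    (S : (T -> R) -> E) (D : set (set T)) (m : set T -> E) :
  ideal_fs lam Y -> lin_op lam Y S ->
  D `<=` sigmaX Y -> (forall A, D A -> m A = S \1_A) ->
  abs_cont (semivar D m) lam.
Proof.
move=> [_ Y0 _ _] [Slin Sae] DY mE A mA A0.
have S0 : S (fun=> 0) = 0.
  have h : S (fun=> 0) = -1 *: S (fun=> 0) + S (fun=> 0).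
    by rewrite -Slin//; congr S; apply/funext => x; rewrite mulr0 addr0.
  by rewrite h scaleN1r addNr.
have m0 B : D B -> B `<=` A -> m B = 0.
  move=> DB BA; rewrite mE// -S0; apply: Sae => //; first by case: (DY _ DB).
  exists A; split=> // x /=; apply: contra_notP => nAx.
  by rewrite indicE memNset// => /BA.
apply/eqP; rewrite eq_le; apply/andP; split.
  apply: ge_ereal_sup => _ [xs [dxs _] <-].
  apply: ge_ereal_sup => _ [n [F [DF _ ->]]].
  rewrite big1// => i _; have [DFi FiA] := DF i (ltn_ord i).
  by rewrite /= m0// (dual0 _ _ _ dxs) normr0.
(* Nonnegativity of the supremum requires some member of [dual_ball]; for it the empty family
   contributes the sum 0. *)
have [xs [xsb _]] := hahn_banach_norming R E 0.
apply: (@le_trans _ _ (Defs.variation D (xs \o m) A)).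
  apply: ereal_sup_ubound; exists 0%N, (fun=> set0); split=> //.
  by rewrite big_ord0.
by apply: ereal_sup_ubound; exists xs.
Qed.

(** Scaled by [C^-1], the functional enters [dual_ball], and the one-piece family [B] bounds its
    value by the semivariation of [N]. Thus [N] is null for both variations of [xs \o m]. *)
Lemma semivar0_null (D : set (set T)) (m : set T -> E) N xs :
  semivar D m N = 0%E -> dual xs ->
  forall B, D B -> B `<=` N -> xs (m B) = 0.
Proof.
move=> N0 dxs B DB BN; have [C C0 hC] := dual_bounded _ _ _ dxs.
have [xslin xscont] := dxs.
have dys : dual_ball (fun u => C^-1 * xs u).
  split; first split.
  - by move=> a u v; rewrite xslin mulrDr mulrCA.
  - by move=> x; apply: cvgMr; exact: xscont.
  - move=> u; rewrite normrM gtr0_norm ?invr_gt0//.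
    by rewrite ler_pdivrMl.
have : (`|C^-1 * xs (m B)|%:E <= semivar D m N)%E.
  apply: (@le_trans _ _ (Defs.variation D ((fun u => C^-1 * xs u) \o m) N)).
    apply: ereal_sup_ubound; exists 1%N, (fun=> B); split=> //.
    - by move=> [|//] [|//].
    - by rewrite big_ord_recl big_ord0 addr0.
  by apply: ereal_sup_ubound; exists (fun u => C^-1 * xs u).
rewrite N0 lee_fin normr_le0 mulf_eq0 invr_eq0 gt_eqF//= => /eqP.
exact.
Qed.

(** Off [N] the sequence lies between 0 and its limit, so [f] itself serves as the dominating
    function. *)
Lemma monotone_integral_cvg (p : {measure set T -> \bar R})
    (fn : nat -> T -> R) (f : T -> R) (N : set T) :
  (forall n, measurable_fun setT (fn n)) -> measurable_fun setT f ->
  measurable N -> p N = 0%E ->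
  (forall x, ~ N x -> [/\ forall n, 0 <= fn n x,
    nondecreasing_seq (fun n => fn n x) & (fun n => fn n x) @ \oo --> f x]) ->
  (\int[p]_x (`|f x|)%:E < +oo)%E ->
  (\int[p]_x (f x)%:E)%E \is a fin_num /\
  (fun n => \int[p]_x (fn n x)%:E)%E @ \oo --> (\int[p]_x (f x)%:E)%E.
Proof.
move=> mfn mf mN N0 hN intf.
have If : p.-integrable setT (EFin \o f).
  by apply/integrableP; split=> //; exact/measurable_EFinP.
split; first exact: integrable_fin_num.
have [|||||] := dominated_convergence measurableT
    (f_ := fun n => EFin \o fn n) (f := EFin \o f) (g := EFin \o f) (mu := p) => //.
- by move=> n; apply/measurable_EFinP.
- exact/measurable_EFinP.
- exists N; split=> // x /=; apply: contra_notP => /hN[_ _ cv] _.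
  by apply: cvg_EFin; [exact: nearW|].
- exists N; split=> // x /=; apply: contra_notP => /hN[fn0 nd cv] n _ /=.
  rewrite lee_fin ger0_norm// -(cvg_lim _ cv)//.
  by apply: nondecreasing_cvgn_le => //; apply/cvg_ex; exists (f x).
Qed.

(** Tested against [xs], the vector integral is a difference of integrals against two measures for
    which the exceptional set is null; both terms converge. *)
Lemma Ivint_order_w_cont (D : set (set T)) (m : set T -> E) :
  measurable_ideal D -> (forall xs, dual xs -> sigma_additive_on D (xs \o m)) ->
  order_w_cont (semivar D m) (L1v D m) (Ivint D m).
Proof.
move=> Did mS fn f L1fn L1f [N [mN N0 hN]] xs dxs.
have [p [q [pE qE vE]]] := variation_measures Did (mS _ dxs).
have null := semivar0_null _ _ _ _ N0 dxs.
have p0 : p N = 0%E.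
  apply/eqP; rewrite eq_le measure_ge0 andbT pE.
  by apply: ge_ereal_sup => _ [B [DB BN] <-]; rewrite /= null.
have q0 : q N = 0%E.
  apply/eqP; rewrite eq_le measure_ge0 andbT qE.
  by apply: ge_ereal_sup => _ [B [DB BN] <-]; rewrite /= null// oppr0.
have mfn n : measurable_fun setT (fn n) by case: (L1fn n).
have [mf intf _] := L1f.
have {}hN x : ~ N x -> [/\ forall n, 0 <= fn n x,
    nondecreasing_seq (fun n => fn n x) & (fun n => fn n x) @ \oo --> f x].
  by move=> nNx; apply: contrapT => h; apply: nNx; exact: hN.
have := intf _ dxs; rewrite vE ge0_integral_measure_add//; last first.
  by apply/measurable_EFinP; exact: measurableT_comp.
move=> intpq.
have intp : (\int[p]_x (`|f x|)%:E < +oo)%E.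
  by apply: le_lt_trans intpq; rewrite leeDl// integral_ge0.
have intq : (\int[q]_x (`|f x|)%:E < +oo)%E.
  by apply: le_lt_trans intpq; rewrite leeDr// integral_ge0.
have [pf pcv] := monotone_integral_cvg p fn f N mfn mf mN p0 hN intp.
have [qf qcv] := monotone_integral_cvg q fn f N mfn mf mN q0 hN intq.
have sintE g : L1v D m g ->
    ((xs (Ivint D m g))%:E = \int[p]_x (g x)%:E - \int[q]_x (g x)%:E)%E.
  by move=> /L1v_Ivint -> //; rewrite /sint -pE -qE.
(* The limit is taken in the extended reals, where finiteness of the two limit integrals justifies
   the subtraction. *)
suff : (fun n => (xs (Ivint D m (fn n)))%:E) @ \oo --> (xs (Ivint D m f))%:E.
  by move=> /fine_cvgP[_].
rewrite sintE//; under eq_fun do rewrite sintE//.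
by apply: cvgeB => //; rewrite fin_num_adde_defr.
Qed.

Lemma sigma_additive_dual (lam : {measure set T -> \bar R}) (Y : set (T -> R))
    (S : (T -> R) -> E) (D : set (set T)) (m : set T -> E) xs :
  ideal_fs lam Y -> lin_op lam Y S -> order_w_cont lam Y S ->
  measurable_ideal D -> D `<=` sigmaX Y -> (forall A, D A -> m A = S \1_A) ->
  dual xs -> sigma_additive_on D (xs \o m).
Proof.
move=> Yid Slin Scont Did DY mE dxs.
apply: (functional_sigma_additive (ideal_fs_solid _ _ Yid)
  (dual_monotone_continuous _ _ _ _ Slin Scont dxs) Did).
- by move=> A /DY[].
- by move=> A DA /=; rewrite mE.
Qed.

(** The vector integral of [f] over [A] is [S] applied to [f] restricted to [A]. Keeping [D] apart
    from [sigmaX Y] covers optimality, where [D] comes from the smaller space [X] and [Y] is [Z]. *)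
Lemma factor_through_L1v (lam : {measure set T -> \bar R}) (Y : set (T -> R))
    (S : (T -> R) -> E) (D : set (set T)) (m : set T -> E) (Om : nat -> set T) :
  ideal_fs lam Y -> lin_op lam Y S -> order_w_cont lam Y S ->
  measurable_ideal D -> D `<=` sigmaX Y -> (forall A, D A -> m A = S \1_A) ->
  (forall n, D (Om n)) -> \bigcup_n Om n = setT ->
  forall f, Y f -> L1v D m f /\ S f = Ivint D m f.
Proof.
move=> Yid Slin Scont Did DY mE DOm Om_cover f Yf.
have sintE xs (dxs : dual xs) := sint_representation (ideal_fs_solid _ _ Yid)
  (dual_monotone_continuous _ _ _ _ Slin Scont dxs) Did
  (fun A DA => (DY A DA).2) (nu := xs \o m)
  (fun A DA => congr1 xs (mE A DA)) DOm Om_cover f Yf.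
have fA A : measurable A -> is_vint D m A f (S (f \_ A)).
  by move=> mA xs dxs; rewrite (sintE xs dxs).2.
split; first split.
- by case: Yid => mY _ _ _; exact: mY.
- by move=> xs dxs; exact: (sintE xs dxs).1.
- by move=> A mA; exists (S (f \_ A)); exact: fA.
by apply/esym/IvintE; have := fA _ measurableT; rewrite patch_setT.
Qed.

End vector_valued.

(** * Factorization through the vector integral and its optimality *)

Theorem theorem3p2 (R : realType) (d : measure_display) (Om : measurableType d)
  (mu : {measure set Om -> \bar R}) (X : set (Om -> R))
  (E : completeNormedModType R) (Top : (Om -> R) -> E) :
  ideal_fs mu X -> sigma_prop X ->
  lin_op mu X Top -> order_w_cont mu X Top ->
  let D := sigmaX X in
  let m := mT Top in
  [/\ abs_cont (semivar D m) mu /\ X `<=` L1v D m,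
      forall f, X f -> Top f = Ivint D m f,
      order_w_cont (semivar D m) (L1v D m) (Ivint D m) &
      forall (xi : {measure set Om -> \bar R}) (Z : set (Om -> R))
             (S : (Om -> R) -> E),
        abs_cont xi mu -> ideal_fs xi Z ->
        X `<=` Z ->
        lin_op xi Z S -> order_w_cont xi Z S ->
        (forall f, X f -> Top f = S f) ->
        (abs_cont (semivar D m) xi /\ Z `<=` L1v D m) /\
        (forall f, Z f -> S f = Ivint D m f)].
Proof.
move=> Xid [W [mW XW Wcover]] Tlin Tcont D m.
have Did : measurable_ideal D by exact: sigmaX_ideal Xid.
have DW n : D (W n) by split.
(* The inclusion of [X] in [Z] places [D] in [sigmaX Z], and [m] is given by [S] on [D]. The
   instance at [mu], [X] and [Top] yields the factorization itself. *)
have factor (xi : {measure set Om -> \bar R}) (Z : set (Om -> R))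
    (S : (Om -> R) -> E) : ideal_fs xi Z -> X `<=` Z ->
    lin_op xi Z S -> order_w_cont xi Z S -> (forall f, X f -> Top f = S f) ->
    (abs_cont (semivar D m) xi /\ Z `<=` L1v D m) /\
    (forall f, Z f -> S f = Ivint D m f).
  move=> Zid XZ Slin Scont TS.
  have DZ : D `<=` sigmaX Z by move=> A [mA XA]; split=> //; exact: XZ.
  have mE A : D A -> m A = S \1_A by move=> [_ XA]; exact: TS.
  have h := factor_through_L1v _ _ _ _ _ _ Zid Slin Scont Did DZ mE DW Wcover.
  split; last by move=> f /h[].
  split; last by move=> f /h[].
  exact: semivar_abs_cont Zid Slin DZ mE.
have [L1X TE] := factor mu X Top Xid (fun _ Xf => Xf) Tlin Tcont (fun _ _ => erefl).
split=> //.
- apply: Ivint_order_w_cont => // xs dxs.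
  exact: (sigma_additive_dual _ _ _ _ _ _ Xid Tlin Tcont Did (fun _ DA => DA)).
- by move=> xi Z S _; exact: factor.
Qed.
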